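(* The NBB bases of $\hat 1$ in $NC_n$, with respect to the partial order $\unlhd$ on $A(NC_n)$, are exactly the sets $B$ obtained by picking exactly one element from each rank of $(A(NC_n),\unlhd)$ in such a way that the corresponding graph $G_B$ is non-crossing.
   Context: A partition $\pi$ of $[n]=\{1,\dots,n\}$ is non-crossing if there do not exist $i,k\in B$ and $j,l\in C$, for two distinct blocks $B,C$ of $\pi$, with $i<j<k<l$. $NC_n$ is the lattice of non-crossing partitions of $[n]$ ordered by refinement, with least element $\hat 0$ (all blocks singletons) and greatest element $\hat 1$ (one block). Its set of atoms $A(NC_n)$ consists of the partitions, denoted $ij$ with $i<j$, whose only non-singleton block is $\{i,j\}$. A set $B$ of atoms is regarded as a graph $G_B$ on vertex set $[n]$ with one edge $\{i,j\}$ for each atom $ij\in B$. A graph on $[n]$ is non-crossing if there are no edges $ik$, $jl$ with $i<j<k<l$. The partial order $\unlhd$ on $A(NC_n)$ is defined by $ij\lhd i'j'$ if and only if $j<j'$; it is ranked, the elements of rank $j-2$ being all atoms of the form $ij$ with $i<j$ (for $2\le j\le n$). For a finite lattice $L$ with order $\le$ and a partial order $\unlhd$ on its atom set $A(L)$, a nonempty $D\subseteq A(L)$ is bounded below (BB) if for every $d\in D$ there is $a\in A(L)$ with $a\lhd d$ and $a<\bigvee D$. A set $B\subseteq A(L)$ is NBB if it contains no BB subset; an NBB base of $x\in L$ is an NBB set $B$ with $\bigvee B=x$ (where $\bigvee\emptyset=\hat 0$). *)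

(* Defs.v *)
From HB Require Import structures.
From mathcomp Require Import all_boot all_order.

Set Implicit Arguments.
Unset Strict Implicit.
Unset Printing Implicit Defensive.

Import Order.TTheory.

(** * Atoms and NBB bases in a finite lattice *)

Definition atoms (d : Order.disp_t) (L : finTBLatticeType d) : {set L} :=
  [set a | (\bot < a)%O && [forall x : L, (x < a)%O ==> (x == \bot%O)]].

(* The relation [tle] stands for the partial order on the set of atoms; it is
   only ever evaluated at atoms, and its strict part is [tlt tle]. *)
Definition tlt (T : eqType) (tle : rel T) : rel T :=
  fun a b => (a != b) && tle a b.

Definition bounded_below (d : Order.disp_t) (L : finTBLatticeType d)
    (tle : rel L) (D : {set L}) : Prop :=
  [/\ D != set0, D \subset atoms L &
      forall x, x \in D -> exists a : L,
        [/\ a \in atoms L, tlt tle a x & (a < \join_(y in D) y)%O]].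

Definition NBB (d : Order.disp_t) (L : finTBLatticeType d)
    (tle : rel L) (B : {set L}) : Prop :=
  B \subset atoms L /\
  forall D : {set L}, D \subset B -> ~ bounded_below tle D.

Definition NBB_base (d : Order.disp_t) (L : finTBLatticeType d)
    (tle : rel L) (x : L) (B : {set L}) : Prop :=
  NBB tle B /\ (\join_(y in B) y)%O = x.

(** * The lattice of non-crossing partitions *)

(* The ground set {1, ..., n} is represented by 'I_n = {0, ..., n - 1}, the
   element x corresponding to x - 1. *)
Definition noncrossing (n : nat) (p : {set {set 'I_n}}) : bool :=
  [forall B in p, forall C in p, (B != C) ==>
     ~~ [exists i in B, exists k in B, exists j in C, exists l in C,
           [&& i < j, j < k & k < l]]].

Record NC (n : nat) := NCPart {
  blocks :> {set {set 'I_n}};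
  _ : partition blocks [set: 'I_n] && noncrossing blocks
}.

HB.instance Definition _ n := [isSub for @blocks n].
HB.instance Definition _ n := [Finite of NC n by <:].

Definition refines (n : nat) (p q : NC n) : bool :=
  [forall A in blocks p, exists B in blocks q, A \subset B].

Lemma noncrossingP n (p : {set {set 'I_n}}) :
  reflect (forall B C, B \in p -> C \in p -> forall i j k l : 'I_n,
             i \in B -> k \in B -> j \in C -> l \in C ->
             i < j -> j < k -> k < l -> B = C)
          (noncrossing p).
Proof.
apply: (iffP idP) => [/forall_inP nc B C Bp Cp i j k l iB kB jC lC ij jk kl|nc].
  apply/eqP; move/forall_inP: (nc B Bp) => /(_ C Cp).
  case: eqP => //= _ /negP[].
  apply/exists_inP; exists i => //; apply/exists_inP; exists k => //.
  apply/exists_inP; exists j => //; apply/exists_inP; exists l => //.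
  by rewrite ij jk kl.
apply/forall_inP => B Bp; apply/forall_inP => C Cp; apply/implyP => /eqP BC.
apply/negP => /exists_inP[i iB] /exists_inP[k kB] /exists_inP[j jC].
case/exists_inP=> l lC /and3P[ij jk kl].
exact: BC (nc B C Bp Cp i j k l iB kB jC lC ij jk kl).
Qed.

Lemma NC_partition n (p : NC n) : partition p [set: 'I_n].
Proof. by case: p => p /= /andP[]. Qed.

Lemma NC_noncrossing n (p : NC n) : noncrossing p.
Proof. by case: p => p /= /andP[]. Qed.

Lemma NC_mem_pblock n (p : NC n) x : x \in pblock p x.
Proof. by rewrite mem_pblock (cover_partition (NC_partition p)) inE. Qed.

Lemma NC_pblock_mem n (p : NC n) x : pblock p x \in blocks p.
Proof.
by apply: pblock_mem; rewrite (cover_partition (NC_partition p)) inE.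
Qed.

Lemma NC_def_pblock n (p : NC n) A x : A \in blocks p -> x \in A -> pblock p x = A.
Proof. exact: def_pblock (partition_trivIset (NC_partition p)). Qed.

Lemma NC_same_pblock n (p : NC n) x y :
  y \in pblock p x -> pblock p x = pblock p y.
Proof.
by move=> h; rewrite (NC_def_pblock (NC_pblock_mem p x) h).
Qed.

Lemma refinesP n (p q : NC n) :
  reflect (forall x, pblock p x \subset pblock q x) (refines p q).
Proof.
apply: (iffP forall_inP) => [pq x|pq A Ap].
  have /exists_inP[B Bq sB] := pq _ (NC_pblock_mem p x).
  by rewrite (NC_def_pblock Bq (subsetP sB _ (NC_mem_pblock p x))).
have /set0Pn[x xA] : A != set0.
  apply/eqP => A0; case/and3P: (NC_partition p) => _ _.
  by rewrite -A0 Ap.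
apply/exists_inP; exists (pblock q x); first exact: NC_pblock_mem.
by rewrite -(NC_def_pblock Ap xA).
Qed.

Lemma NC_blocksE n (p : NC n) : blocks p = [set pblock p x | x : 'I_n].
Proof.
apply/setP => A; apply/idP/imsetP => [Ap|[x _ ->]]; last exact: NC_pblock_mem.
have /set0Pn[x xA] : A != set0.
  apply/eqP => A0; case/and3P: (NC_partition p) => _ _.
  by rewrite -A0 Ap.
by exists x => //; rewrite (NC_def_pblock Ap xA).
Qed.

Lemma NC_pblock_inj n (p q : NC n) : pblock p =1 pblock q -> p = q.
Proof.
move=> pq; apply: val_inj; rewrite /= [LHS]NC_blocksE [RHS]NC_blocksE.
by apply: eq_imset => x; rewrite pq.
Qed.

Lemma refines_refl n : reflexive (@refines n).
Proof. by move=> p; apply/refinesP. Qed.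

Lemma refines_anti n : antisymmetric (@refines n).
Proof.
move=> p q /andP[/refinesP pq /refinesP qp]; apply: NC_pblock_inj => x.
by apply/eqP; rewrite eqEsubset pq qp.
Qed.

Lemma refines_trans n : transitive (@refines n).
Proof.
move=> q p r /refinesP pq /refinesP qr; apply/refinesP => x.
exact: subset_trans (pq x) (qr x).
Qed.

Fact NC_display : Order.disp_t. Proof. exact: Order.Disp tt tt. Qed.

HB.instance Definition _ n :=
  Order.Le_isPOrder.Build NC_display (NC n)
    (@refines_refl n) (@refines_anti n) (@refines_trans n).

(* Greatest lower bound of a set of non-crossing partitions: two points are in
   the same block iff they are in the same block of all the members of [S].
   All the lattice operations are obtained from it. *)
Definition NC_inf_rel n (S : {set NC n}) : rel 'I_n :=
  fun x y => [forall p in S, y \in pblock (blocks p) x].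

Lemma NC_inf_equiv n (S : {set NC n}) :
  {in [set: 'I_n] & &, equivalence_rel (NC_inf_rel S)}.
Proof.
move=> x y z _ _ _; split.
  by apply/forall_inP => p _; apply: NC_mem_pblock.
move=> /forall_inP xy; apply: eq_forallb_in => p pS.
by rewrite (NC_same_pblock (xy p pS)).
Qed.

Lemma NC_inf_pblock n (S : {set NC n}) x y :
  (y \in pblock (equivalence_partition (NC_inf_rel S) setT) x) =
  NC_inf_rel S x y.
Proof. by rewrite (pblock_equivalence_partition (@NC_inf_equiv _ S)) ?inE. Qed.

Lemma NC_inf_subproof n (S : {set NC n}) :
  partition (equivalence_partition (NC_inf_rel S) setT) [set: 'I_n] &&
  noncrossing (equivalence_partition (NC_inf_rel S) setT).
Proof.
set p := equivalence_partition _ _; have pp : partition p setT.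
  exact: (equivalence_partitionP (@NC_inf_equiv _ S)).
rewrite pp /=; have tp := partition_trivIset pp.
apply/noncrossingP => B C Bp Cp i j k l iB kB jC lC ij jk kl.
rewrite -(def_pblock tp Bp iB) -(def_pblock tp Cp jC).
have ik : NC_inf_rel S i k by rewrite -NC_inf_pblock (def_pblock tp Bp iB).
have jl : NC_inf_rel S j l by rewrite -NC_inf_pblock (def_pblock tp Cp jC).
apply: same_pblock => //; rewrite NC_inf_pblock; apply/forall_inP => q qS.
move/forall_inP: ik => /(_ q qS) ik; move/forall_inP: jl => /(_ q qS) jl.
have /noncrossingP nq := NC_noncrossing q.
have <- : pblock q i = pblock q j; last exact: NC_mem_pblock.
by apply: (nq _ _ _ _ i j k l); rewrite ?NC_pblock_mem ?NC_mem_pblock.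
Qed.

Definition NC_inf n (S : {set NC n}) : NC n := NCPart (NC_inf_subproof S).

Lemma le_NC_inf n (S : {set NC n}) (z : NC n) :
  (z <= NC_inf S)%O = [forall p in S, (z <= p)%O].
Proof.
apply/refinesP/forall_inP => [zS p pS|zS x].
  apply/refinesP => x; apply/subsetP => y /(subsetP (zS x)).
  by rewrite NC_inf_pblock => /forall_inP; apply.
apply/subsetP => y yx; rewrite NC_inf_pblock; apply/forall_inP => p pS.
by move/refinesP: (zS p pS) => /(_ x) /subsetP; apply.
Qed.

Lemma NC_meetP n (p q r : NC n) :
  (p <= NC_inf [set q; r])%O = (p <= q)%O && (p <= r)%O.
Proof.
rewrite le_NC_inf; apply/forall_inP/andP => [h|[pq pr] s].
  by rewrite !h ?inE ?eqxx ?orbT.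
by rewrite !inE => /orP[]/eqP->.
Qed.

Lemma NC_joinP n (p q r : NC n) :
  (NC_inf [set s | (p <= s)%O && (q <= s)%O] <= r)%O =
  (p <= r)%O && (q <= r)%O.
Proof.
set S := [set _ | _]; have ub z : (forall s, s \in S -> z <= s)%O -> (z <= NC_inf S)%O.
  by move=> h; rewrite le_NC_inf; apply/forall_inP.
apply/idP/idP => [Sr|pqr].
  apply/andP; split; apply: (le_trans _ Sr); apply: ub => s;
  by rewrite inE => /andP[].
have : (NC_inf S <= NC_inf S)%O by [].
by rewrite le_NC_inf => /forall_inP; apply; rewrite inE.
Qed.

Lemma NC_bottomP n (p : NC n) : (NC_inf [set: NC n] <= p)%O.
Proof.
have : (NC_inf [set: NC n] <= NC_inf [set: NC n])%O by [].
by rewrite le_NC_inf => /forall_inP; apply; rewrite inE.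
Qed.

Lemma NC_topP n (p : NC n) : (p <= NC_inf set0)%O.
Proof. by rewrite le_NC_inf; apply/forall_inP => q; rewrite inE. Qed.

HB.instance Definition _ n :=
  Order.POrder_isMeetSemilattice.Build NC_display (NC n) (@NC_meetP n).
HB.instance Definition _ n :=
  Order.POrder_isJoinSemilattice.Build NC_display (NC n) (@NC_joinP n).
HB.instance Definition _ n :=
  Order.hasBottom.Build NC_display (NC n) (@NC_bottomP n).
HB.instance Definition _ n :=
  Order.hasTop.Build NC_display (NC n) (@NC_topP n).

(** * The atoms ij of NC_n, their partial order and its ranks *)

Definition nc_atom_blocks (n : nat) (i j : 'I_n) : {set {set 'I_n}} :=
  [set i; j] |: [set [set x] | x in ~: [set i; j]].

Lemma nc_atom_subproof n (i j : 'I_n) :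
  partition (nc_atom_blocks i j) [set: 'I_n] && noncrossing (nc_atom_blocks i j).
Proof.
have memP A : A \in nc_atom_blocks i j ->
    A = [set i; j] \/ exists2 x, x \notin [set i; j] & A = [set x].
  case/setU1P => [->|/imsetP[x]]; first by left.
  by rewrite in_setC; right; exists x.
apply/andP; split.
  apply/and3P; split.
  - apply/eqP/setP => x; rewrite in_setT; apply/bigcupP.
    have [xij|xij] := boolP (x \in [set i; j]).
      by exists [set i; j] => //; rewrite setU11.
    exists [set x]; last by rewrite in_set1.
    by apply/setU1P; right; apply/imsetP; exists x; rewrite ?in_setC.
  - apply/trivIsetP => A B /memP[->|[x xij ->]] /memP[->|[y yij ->]] AB.
    + by rewrite eqxx in AB.
    + by rewrite disjoint_sym disjoints1.
    + by rewrite disjoints1.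
    + by rewrite disjoints1 in_set1; apply: contraNneq AB => ->.
  - apply/negP => /memP[/setP/(_ i)|[x _ /setP/(_ x)]];
      by rewrite !inE eqxx.
apply/noncrossingP => B C /memP[->|[x xij ->]] /memP[->|[y yij ->]] a b c d //.
- rewrite !in_set1 => _ _ /eqP-> /eqP-> ab bc cd.
  by have := ltn_trans bc cd; rewrite ltnn.
- rewrite !in_set1 => /eqP-> /eqP-> _ _ ab bc.
  by have := ltn_trans ab bc; rewrite ltnn.
- rewrite !in_set1 => /eqP-> /eqP-> _ _ ab bc.
  by have := ltn_trans ab bc; rewrite ltnn.
Qed.

Definition nc_atom (n : nat) (i j : 'I_n) : NC n := NCPart (nc_atom_subproof i j).

Definition nc_tle (n : nat) : rel (NC n) := fun a b =>
  (a == b) ||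
  [exists i : 'I_n, exists j : 'I_n, exists i' : 'I_n, exists j' : 'I_n,
     [&& i < j, i' < j', a == nc_atom i j, b == nc_atom i' j' & j < j']].

(* In the labelling by {1, ..., n} the atoms ij have rank j - 2, that is, in the
   labelling by {0, ..., n - 1}, rank j - 1. The nonempty ranks are thus those
   with r + 1 < n. *)
Definition nc_rank (n r : nat) : {set NC n} :=
  [set a | [exists i : 'I_n, exists j : 'I_n,
              [&& i < j, j == r.+1 :> nat & a == nc_atom i j]]].

(** * Graphs *)

Definition atom_graph (n : nat) (B : {set NC n}) : rel 'I_n :=
  fun i j => (i != j) && (nc_atom i j \in B).

Definition noncrossing_graph (n : nat) (e : rel 'I_n) : Prop :=
  forall i j k l : 'I_n, i < j -> j < k -> k < l -> ~ (e i k /\ e j l).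

(** * Consistency of the definitions *)

Lemma nc_pblock_atom n (i j x : 'I_n) :
  pblock (nc_atom i j) x = if x \in [set i; j] then [set i; j] else [set x].
Proof.
case: ifPn => xij; apply: NC_def_pblock; rewrite ?in_set1 //=.
  exact: setU11.
by apply/setU1P; right; apply/imsetP; exists x; rewrite ?in_setC.
Qed.

Lemma nc_atom_le n (i j : 'I_n) (p : NC n) :
  (nc_atom i j <= p)%O = (j \in pblock p i).
Proof.
apply/refinesP/idP => [h|ij x].
  by apply: (subsetP (h i)); rewrite nc_pblock_atom !inE eqxx /= !inE eqxx orbT.
rewrite nc_pblock_atom; case: ifPn => [|_]; last by rewrite sub1set NC_mem_pblock.
rewrite !inE => /orP[]/eqP->; apply/subsetP => y; rewrite !inE => /orP[]/eqP-> //.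
- exact: NC_mem_pblock.
- by rewrite -(NC_same_pblock ij) NC_mem_pblock.
- exact: NC_mem_pblock.
Qed.

Lemma NC_pblock_sym n (p : NC n) x y : (y \in pblock p x) = (x \in pblock p y).
Proof.
by apply/idP/idP => /NC_same_pblock <-; apply: NC_mem_pblock.
Qed.

Lemma nc_atomC n (i j : 'I_n) : nc_atom i j = nc_atom j i.
Proof.
by apply/le_anti; rewrite !nc_atom_le !nc_pblock_atom !inE !eqxx ?orbT /= !inE !eqxx ?orbT.
Qed.

Lemma NC_bottomE n : blocks (\bot%O : NC n) = [set [set x] | x : 'I_n].
Proof.
rewrite NC_blocksE; apply: eq_imset => x; apply/eqP.
rewrite eqEsubset sub1set NC_mem_pblock andbT.
have : (\bot%O <= nc_atom x x)%O by apply: le0x.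
by move/refinesP/(_ x); rewrite nc_pblock_atom !inE eqxx setUid.
Qed.

Lemma NC_topE n : blocks (\top%O : NC n.+1) = [set [set: 'I_n.+1]].
Proof.
have top x : pblock (\top%O : NC n.+1) x = setT.
  apply/setP => y; rewrite in_setT.
  by have := lex1 (nc_atom x y); rewrite nc_atom_le.
rewrite NC_blocksE; apply/setP => A; rewrite in_set1.
apply/imsetP/eqP => [[x _ ->]|->]; first exact: top.
by exists ord0.
Qed.

Lemma NC_pblock_bottom n (x : 'I_n) : pblock (\bot%O : NC n) x = [set x].
Proof.
apply: NC_def_pblock; last by rewrite in_set1.
by rewrite NC_bottomE; apply/imsetP; exists x.
Qed.

Lemma nc_atom_eq0 n (i j : 'I_n) : (nc_atom i j == \bot%O) = (i == j).
Proof. by rewrite -lex0 nc_atom_le NC_pblock_bottom in_set1 eq_sym. Qed.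

Lemma NC_neq0 n (p : NC n) :
  p != \bot%O -> exists i j : 'I_n, i < j /\ (nc_atom i j <= p)%O.
Proof.
move=> p0; have [|/negP np] :=
  boolP [exists i : 'I_n, exists j : 'I_n, (i < j) && (nc_atom i j <= p)%O].
  by case/existsP=> i /existsP[j /andP[]]; exists i, j.
case/eqP: p0; apply: NC_pblock_inj => x; apply/eqP.
rewrite NC_pblock_bottom eqEsubset sub1set NC_mem_pblock andbT.
apply/subsetP => y xy; rewrite in_set1 -val_eqE /=.
case: ltngtP => // [yx|yx]; case: np; apply/existsP.
  by exists y; apply/existsP; exists x; rewrite yx nc_atom_le NC_pblock_sym.
by exists x; apply/existsP; exists y; rewrite yx nc_atom_le.
Qed.

Lemma nc_atom_le_atom n (i j k l : 'I_n) :
  i < j -> k < l -> (nc_atom i j <= nc_atom k l)%O -> i = k /\ j = l.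
Proof.
move=> ij kl; rewrite nc_atom_le nc_pblock_atom; case: ifP => [|_].
  rewrite !inE => /orP[]/eqP ei /orP[]/eqP ej; subst=> //.
  - by rewrite ltnn in ij.
  - by have := ltn_trans ij kl; rewrite ltnn.
  - by rewrite ltnn in ij.
by rewrite in_set1 => /eqP ej; rewrite ej ltnn in ij.
Qed.

Lemma nc_atom_inj n (i j k l : 'I_n) :
  i < j -> k < l -> nc_atom i j = nc_atom k l -> i = k /\ j = l.
Proof. by move=> ij kl e; apply: nc_atom_le_atom => //; rewrite e. Qed.

Lemma nc_atomsP n (a : NC n) :
  reflect (exists i j : 'I_n, i < j /\ a = nc_atom i j) (a \in atoms (NC n)).
Proof.
rewrite inE lt0x; apply: (iffP andP) => [[a0 /forallP amin]|[i [j [ij ->]]]].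
  have [i [j [ij le_a]]] := NC_neq0 a0; exists i, j; split => //.
  have /implyP := amin (nc_atom i j); rewrite lt_neqAle le_a andbT nc_atom_eq0.
  case: eqP => [->//|_] /= /(_ isT) /eqP e.
  by rewrite e ltnn in ij.
have ne : i != j by rewrite -val_eqE ltn_eqF.
split; first by rewrite nc_atom_eq0.
apply/forallP => x; apply/implyP => x_lt; apply/eqP/eqP.
apply: contraTT x_lt => /NC_neq0[k [l [kl le_x]]].
rewrite lt_neqAle; apply/negP => /andP[/eqP nx x_le]; case: nx.
have [ek el] := nc_atom_le_atom kl ij (le_trans le_x x_le); subst.
by apply/le_anti; rewrite x_le le_x.
Qed.

Lemma nc_rankP n r (a : NC n) :
  reflect (exists i j : 'I_n, [/\ i < j, j = r.+1 :> nat & a = nc_atom i j])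
          (a \in nc_rank n r).
Proof.
rewrite inE; apply: (iffP existsP) => [[i /existsP[j /and3P[ij /eqP jr /eqP->]]]|].
  by exists i, j.
by case=> i [j [ij jr ->]]; exists i; apply/existsP; exists j; rewrite ij jr !eqxx.
Qed.

(* [nc_rank] is the rank decomposition of the poset of atoms: every atom lies
   in some [nc_rank n r] with r + 1 < n, these sets are nonempty, and strict
   comparability is comparison of ranks. *)
Lemma nc_atoms_rank n (a : NC n) :
  reflect (exists2 r, r.+1 < n & a \in nc_rank n r) (a \in atoms (NC n)).
Proof.
apply: (iffP (nc_atomsP a)) => [[i [j [ij ->]]]|[r _ /nc_rankP[i [j [ij _ ->]]]]].
  have j0 : 0 < j by apply: leq_ltn_trans ij.
  exists j.-1; rewrite ?prednK //; apply/nc_rankP; exists i, j.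
  by rewrite prednK.
by exists i, j.
Qed.

Lemma nc_rank_neq0 n r : r.+1 < n -> nc_rank n r != set0.
Proof.
move=> rn; apply/set0Pn.
exists (nc_atom (Ordinal (ltn_trans (ltnSn r) rn)) (Ordinal rn)).
by apply/nc_rankP; do 2!eexists; split; last reflexivity.
Qed.

Lemma nc_tlt_rank n r s (a b : NC n) :
  a \in nc_rank n r -> b \in nc_rank n s -> tlt (@nc_tle n) a b = (r < s).
Proof.
case/nc_rankP=> i [j [ij jr ->]] /nc_rankP[i' [j' [ij' js ->]]].
rewrite -[r < s]ltnS -jr -js /tlt /nc_tle.
case: (eqVneq (nc_atom i j)) => [/nc_atom_inj|_] /=.
  by case/(_ ij ij')=> _ ->; rewrite ltnn.
apply/existsP/idP.
  case=> x /existsP[y /existsP[x' /existsP[y' /and5P[xy xy' /eqP e /eqP e' yy']]]].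
  by have [_ ->] := nc_atom_inj ij xy e; have [_ ->] := nc_atom_inj ij' xy' e'.
move=> jj'; exists i; apply/existsP; exists j; apply/existsP; exists i'.
by apply/existsP; exists j'; rewrite ij ij' jj' !eqxx.
Qed.

Lemma nc_tle_refl n : reflexive (@nc_tle n).
Proof. by move=> a; rewrite /nc_tle eqxx. Qed.

Lemma nc_tle_anti n : {in atoms (NC n) &, antisymmetric (@nc_tle n)}.
Proof.
move=> a b /nc_atoms_rank[r _ ar] /nc_atoms_rank[s _ bs] /andP[ab ba].
apply/eqP; apply/negPn/negP => nab.
have := nc_tlt_rank ar bs; have := nc_tlt_rank bs ar.
rewrite /tlt ab ba eq_sym nab => /esym sr /esym rs.
by have := ltn_trans sr rs; rewrite ltnn.
Qed.

Lemma nc_tle_trans n : {in atoms (NC n) & &, transitive (@nc_tle n)}.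
Proof.
move=> b a c /nc_atoms_rank[s _ bs] /nc_atoms_rank[r _ ar] /nc_atoms_rank[t _ ct].
have [->//|nab] := eqVneq a b; have [->//|nbc] := eqVneq b c.
have [->|nac] := eqVneq a c; first by rewrite nc_tle_refl.
have := nc_tlt_rank ar bs; have := nc_tlt_rank bs ct; have := nc_tlt_rank ar ct.
rewrite /tlt nab nbc nac /= => -> -> ->; exact: ltn_trans.
Qed.

(* Main.v *)
Require Import Defs.
From mathcomp Require Import all_boot all_order.
From mathcomp Require Import zify.

Set Implicit Arguments.
Unset Strict Implicit.
Unset Printing Implicit Defensive.

Import Order.TTheory.

(** Everything is read off the graph [atom_graph B], through two facts.

    If the graph of a set of atoms is non-crossing, so is the partition of the
    vertices into connected components, and therefore this partition is the
    join of the set ([components_NC], [noncrossing_joinE]).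

    If moreover every vertex has at most one smaller neighbour, call it the
    parent, then the graph is a forest in which each component has a unique
    vertex without parent ([connected_minima]).

    NBB sets are exactly the sets of atoms whose graph has these two properties
    ([NBB_atom_graphP]).  A crossing pair [ik], [jl], or a pair [yx], [zx] with
    the same upper end, is bounded below, because one block of its join
    contains all these points, so that the join is above [ij], resp. the atom
    on [y] and [z], which has smaller rank than both.  Conversely,
    let the graph of [B] have the two properties and let [D] be a bounded below
    subset of [B], with [j] the smallest upper end of an atom of [D].  An atom
    [kl] below the join of [D] with [l < j] would connect, in the graph of [D],
    two distinct vertices smaller than [j]; but these have no parent there.

    Finally the join of an NBB set is the greatest element iff its graph is
    connected, that is, iff every vertex except [0] has a parent.  Together
    with uniqueness of parents, this says that [B] has exactly one atom in each
    rank. *)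

(** * Connectivity in non-crossing graphs and in forests *)

Section ConnectedGraphs.

Variables (n : nat) (e : rel 'I_n).
Hypothesis e_sym : symmetric e.

Lemma connect_exit (P : pred 'I_n) x y : connect e x y -> P x -> ~~ P y ->
  exists u v, [/\ connect e x u, e u v, P u & ~~ P v].
Proof.
case/connectP=> s; elim: s x => [|z s IHs] x /=.
  by move=> _ -> ->.
case/andP=> xz zs ylast Px nPy; case: (boolP (P z)) => [Pz|nPz].
  have [u [v [zu uv Pu nPv]]] := IHs z zs ylast Pz nPy.
  by exists u, v; split=> //; apply: connect_trans zu; apply: connect1.
by exists x, z; split.
Qed.

(** An edge [uv] cannot be jumped over: a path that leaves the interval between
    its ends has to pass through [u] or [v]. *)
Lemma noncrossing_edge_separates (u v x y : 'I_n) :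
  noncrossing_graph e -> e u v -> connect e x y ->
  u < x < v -> ~~ (u < y < v) -> connect e x u.
Proof.
move=> nce uv xy xin yout.
have [p [q [xp pq /andP[up pv] qout]]] :=
    connect_exit (P := fun z => u < z < v) xy xin yout.
have xq : connect e x q := connect_trans xp (connect1 pq).
case: (ltngtP q u) qout => [qu _|uq /= qv|/val_inj <- //].
  by case: (nce q u p v qu up pv); rewrite e_sym.
case: (ltngtP q v) qv => [//|vq _|/val_inj qv _].
  by case: (nce u p v q up pv vq).
by apply: connect_trans xq _; apply: connect1; rewrite qv e_sym.
Qed.

(** Two crossing paths meet even though their edges do not cross: the path from
    [b] to [d] leaves the interval between [a] and [c] along an edge, and this
    edge separates [a] from [c], so the path from [a] to [c] meets it. *)
Lemma connect_crossing_paths (a b c d : 'I_n) : noncrossing_graph e ->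
  a < b -> b < c -> c < d -> connect e a c -> connect e b d -> connect e a b.
Proof.
move=> nce ab bc cd ac bd; have csym := sym_connect_sym e_sym.
have bin : a < b < c by rewrite ab.
have dout : ~~ (a < d < c) by lia.
have [p [q [bp pq /andP[ap pc] qout]]] :=
    connect_exit (P := fun z => a < z < c) bd bin dout.
have bq : connect e b q := connect_trans bp (connect1 pq).
rewrite csym; case: (ltngtP q a) qout => [qa _|aq /= qc|/val_inj <- //].
  apply: connect_trans bq _; rewrite csym.
  apply: (@noncrossing_edge_separates q p a c) => //; [|lia|lia].
  by rewrite e_sym.
case: (ltngtP q c) qc => [//|cq _|/val_inj qc _].
  apply: connect_trans bp _; rewrite csym; apply: (connect_trans ac).
  by apply: (@noncrossing_edge_separates p q c a); rewrite // 1?csym //; lia.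
by apply: connect_trans bq _; rewrite qc csym.
Qed.

Lemma components_NC : noncrossing_graph e ->
  exists p : NC n, forall x y, (y \in pblock p x) = connect e x y.
Proof.
move=> nce; have csym := sym_connect_sym e_sym.
have eqv : {in [set: 'I_n] & &, equivalence_rel (connect e)}.
  move=> x y z _ _ _; split=> [|xy]; first exact: connect0.
  exact: same_connect csym _ _ xy z.
set P := equivalence_partition (connect e) [set: 'I_n].
have Ppart : partition P [set: 'I_n] by apply: equivalence_partitionP.
have tP := partition_trivIset Ppart.
have PE x y : (y \in pblock P x) = connect e x y.
  by rewrite (pblock_equivalence_partition eqv) ?inE.
have Pnc : noncrossing P.
  apply/noncrossingP => B C BP CP i j k l iB kB jC lC ij jk kl.
  rewrite -(def_pblock tP BP iB) -(def_pblock tP CP jC).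
  apply: same_pblock => //; rewrite PE csym.
  apply: (connect_crossing_paths nce ij jk kl).
    by rewrite -PE (def_pblock tP BP iB).
  by rewrite -PE (def_pblock tP CP jC).
have Pax : partition P [set: 'I_n] && noncrossing P by rewrite Ppart.
by exists (NCPart Pax) => x y; apply: PE.
Qed.

Definition unique_smaller_neighbour :=
  forall x y z : 'I_n, y < x -> z < x -> e x y -> e x z -> y = z.

(** Replacing a vertex by its parent, when it has one, is a map [f] that fixes
    the vertices without parent.  The two ends of an edge have a common iterate
    under [f], hence so do any two connected vertices, and for fixed points a
    common iterate means equality. *)
Lemma connected_minima (x y : 'I_n) :
  irreflexive e -> unique_smaller_neighbour ->
  connect e x y -> (forall z : 'I_n, z < x -> ~~ e x z) ->
  (forall z : 'I_n, z < y -> ~~ e y z) -> x = y.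
Proof.
move=> e_irr uniq_e xy minx miny.
pose f (z : 'I_n) := odflt z [pick w : 'I_n | (w < z) && e z w].
have f_edge (z w : 'I_n) : w < z -> e z w -> f z = w.
  move=> wz ezw; rewrite /f; case: pickP => [v /andP[vz ezv]|/(_ w)] /=.
    exact: uniq_e ezv ezw.
  by rewrite wz ezw.
have f_min (z : 'I_n) : (forall w : 'I_n, w < z -> ~~ e z w) -> f z = z.
  move=> minz; rewrite /f; case: pickP => //= w /andP[wz].
  by rewrite (negbTE (minz w wz)).
suff [k [l]] : exists k l, iter k f x = iter l f y.
  by rewrite !iter_fix ?f_min.
case/connectP: xy => s; elim: s x {minx} => [|z s IHs] x /=.
  by move=> _ ->; exists 0, 0.
case/andP=> xz zs /(IHs z zs)[k [l kl]].
case: (ltngtP x z) => [xz_lt|zx_lt|/val_inj xzE].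
- exists k, l.+1; have zx : e z x by rewrite e_sym.
  by rewrite iterS -kl -iterS iterSr (f_edge _ _ xz_lt zx).
- by exists k.+1, l; rewrite iterSr (f_edge _ _ zx_lt xz).
- by rewrite xzE e_irr in xz.
Qed.

End ConnectedGraphs.

(** * The graph of a set of atoms and its join *)

Section AtomGraphs.

Variable n : nat.
Implicit Types (B D : {set NC n}).

Lemma atom_graph_sym B : symmetric (atom_graph B).
Proof. by move=> x y; rewrite /atom_graph eq_sym nc_atomC. Qed.

Lemma atom_graph_irr B : irreflexive (atom_graph B).
Proof. by move=> x; rewrite /atom_graph eqxx. Qed.

Lemma atom_graphE B (i j : 'I_n) :
  i < j -> atom_graph B i j = (nc_atom i j \in B).
Proof. by move=> ij; rewrite /atom_graph -val_eqE ltn_eqF. Qed.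

Lemma atom_graphS B D : D \subset B -> subrel (atom_graph D) (atom_graph B).
Proof. by move=> /subsetP DB x y /andP[xy /DB xyB]; apply/andP. Qed.

Lemma join_ge_mem B b : b \in B -> (b <= \join_(a in B) a)%O.
Proof. by move=> bB; apply: (joins_sup id). Qed.

Lemma connect_join B x y :
  connect (atom_graph B) x y -> y \in pblock (\join_(b in B) b)%O x.
Proof.
case/connectP=> s; elim: s x => [|z s IHs] x /=.
  by move=> _ ->; apply: NC_mem_pblock.
case/andP=> /andP[_ xzB] zs /(IHs z zs) zy.
have xz : z \in pblock (\join_(b in B) b)%O x.
  by rewrite -nc_atom_le; apply: join_ge_mem.
by rewrite (NC_same_pblock xz).
Qed.

(** The components form a non-crossing partition above all the atoms, so the
    join cannot be coarser.  Without the hypothesis the join may merge crossing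
    components. *)
Lemma noncrossing_joinE B x y :
  B \subset atoms (NC n) -> noncrossing_graph (atom_graph B) ->
  (y \in pblock (\join_(b in B) b)%O x) = connect (atom_graph B) x y.
Proof.
move=> /subsetP Bat ncB; apply/idP/idP; last exact: connect_join.
have [p pE] := components_NC (@atom_graph_sym B) ncB.
rewrite -pE -!nc_atom_le => /le_trans; apply; apply/joinsP => b bB.
have /nc_atomsP[i [j [ij bE]]] := Bat b bB.
by rewrite bE nc_atom_le pE connect1 // atom_graphE // -bE.
Qed.

(** * NBB sets of atoms *)

(** The strict inequality [a < \join_(y in D) y] can be relaxed: if the atom [a]
    were the whole join, the element [d] of [D] would be below [a], hence equal
    to it, whereas [a] has smaller rank. *)
Lemma bounded_belowP D :
  bounded_below (@nc_tle n) D <->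
  [/\ D != set0, D \subset atoms (NC n) &
      forall i j : 'I_n, i < j -> nc_atom i j \in D ->
      exists k l : 'I_n, [/\ k < l, l < j & l \in pblock (\join_(d in D) d)%O k]].
Proof.
have rk (i j : 'I_n) : i < j -> nc_atom i j \in nc_rank n j.-1.
  by move=> ij; apply/nc_rankP; exists i, j; split=> //; lia.
split=> -[D0 Dat DBB]; split=> //.
  move=> i j ij /DBB[a [/nc_atomsP[k [l [kl ->]]]]].
  rewrite (nc_tlt_rank (rk _ _ kl) (rk _ _ ij)) => lj /ltW.
  by rewrite nc_atom_le; exists k, l; split=> //; lia.
move=> d dD; have /nc_atomsP[i [j [ij dE]]] := subsetP Dat d dD.
rewrite dE in dD *; have [k [l [kl lj lk]]] := DBB i j ij dD.
exists (nc_atom k l); split; first by apply/nc_atomsP; exists k, l.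
  by rewrite (nc_tlt_rank (rk _ _ kl) (rk _ _ ij)); lia.
rewrite lt_neqAle nc_atom_le lk andbT; apply/eqP => klE.
have : (nc_atom i j <= nc_atom k l)%O by rewrite klE join_ge_mem.
by case/(nc_atom_le_atom ij kl) => _ jl; rewrite jl ltnn in lj.
Qed.

Lemma bounded_below_pair (a b c d k l : 'I_n) :
  a < b -> c < d -> k < l -> l < b -> l < d ->
  l \in pblock (\join_(x in [set nc_atom a b; nc_atom c d]) x)%O k ->
  bounded_below (@nc_tle n) [set nc_atom a b; nc_atom c d].
Proof.
move=> ab cd kl lb ld lk; apply/bounded_belowP; split.
- by apply/set0Pn; exists (nc_atom a b); rewrite set21.
- apply/subsetP => x /set2P[]->; apply/nc_atomsP; first by exists a, b.
  by exists c, d.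
move=> i j ij ijD; exists k, l; split=> //.
by case/set2P: ijD => /nc_atom_inj[] // _ ->.
Qed.

Lemma NBB_noncrossing B :
  NBB (@nc_tle n) B -> noncrossing_graph (atom_graph B).
Proof.
case=> _ nBB i j k l ij jk kl [ik jl].
rewrite !atom_graphE in ik jl; [|lia|lia].
pose D := [set nc_atom i k; nc_atom j l].
apply: (nBB D); first by apply/subsetP => x /set2P[]->.
(* The points i, j, k, l lie in one block of the join, so it is above ij. *)
apply: (@bounded_below_pair i k j l i j); try lia.
set p := (\join_(x in D) x)%O.
have ikp : k \in pblock p i by rewrite -nc_atom_le join_ge_mem // set21.
have jlp : l \in pblock p j by rewrite -nc_atom_le join_ge_mem // set22.
have /noncrossingP ncp := NC_noncrossing p.
rewrite (ncp (pblock p i) (pblock p j) _ _ i j k l);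
  by rewrite ?NC_pblock_mem ?NC_mem_pblock.
Qed.

Lemma NBB_unique_smaller_neighbour B :
  NBB (@nc_tle n) B -> unique_smaller_neighbour (atom_graph B).
Proof.
case=> _ nBB.
suff wlt (x y z : 'I_n) : y < z -> z < x ->
    atom_graph B x y -> atom_graph B x z -> False.
  move=> x y z yx zx xy xz; case: (ltngtP y z) => [yz|zy|/val_inj //].
    by case: (wlt x y z yz zx xy xz).
  by case: (wlt x z y zy yx xz xy).
move=> yz zx; rewrite ![atom_graph B x _]atom_graph_sym !atom_graphE //;
  last by lia.
move=> xy xz; pose D := [set nc_atom y x; nc_atom z x].
apply: (nBB D); first by apply/subsetP => w /set2P[]->.
apply: (@bounded_below_pair y x z x y z); try lia.
set p := (\join_(w in D) w)%O.
have yp : x \in pblock p y by rewrite -nc_atom_le join_ge_mem // set21.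
have zp : x \in pblock p z by rewrite -nc_atom_le join_ge_mem // set22.
by rewrite (NC_same_pblock yp) -(NC_same_pblock zp) NC_mem_pblock.
Qed.

Lemma NBB_atom_graphP B :
  NBB (@nc_tle n) B <->
  [/\ B \subset atoms (NC n), noncrossing_graph (atom_graph B)
    & unique_smaller_neighbour (atom_graph B)].
Proof.
split=> [nB|[Bat ncB uB]].
  split; [by case: nB | exact: NBB_noncrossing |].
  exact: NBB_unique_smaller_neighbour.
split=> // D DB /bounded_belowP[/set0Pn[d0 d0D] Dat DBB].
have DBg := atom_graphS DB.
have ncD : noncrossing_graph (atom_graph D).
  by move=> i j k l ij jk kl [/DBg ik /DBg jl]; apply: (ncB i j k l).
have uD : unique_smaller_neighbour (atom_graph D).
  by move=> x y z yx zx /DBg xy /DBg; apply: uB.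
pose top (j : 'I_n) := [exists i : 'I_n, (i < j) && (nc_atom i j \in D)].
have [j0 j0top] : exists j, top j.
  have /nc_atomsP[i [j [ij d0E]]] := subsetP Dat d0 d0D.
  by exists j; apply/existsP; exists i; rewrite ij -d0E.
(* The vertex j is the smallest upper end of an atom of D, so that no vertex
   smaller than j has a smaller neighbour in the graph of D. *)
case: (@arg_minnP _ j0 top (fun j => j : nat) j0top) => j.
case/existsP=> i /andP[ij ijD] jmin.
have [k [l [kl lj]]] := DBB i j ij ijD.
rewrite noncrossing_joinE // => kl_conn.
have below (x : 'I_n) : x < j -> forall z : 'I_n, z < x -> ~~ atom_graph D x z.
  move=> xj z zx; apply/negP; rewrite atom_graph_sym atom_graphE // => zxD.
  suff /jmin : top x by lia.
  by apply/existsP; exists z; rewrite zx.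
have klE := connected_minima (@atom_graph_sym D) (@atom_graph_irr D) uD kl_conn
  (below k (ltn_trans kl lj)) (below l lj).
by rewrite klE ltnn in kl.
Qed.

(** * NBB bases of the greatest element *)

Lemma join_topP B :
  (\join_(b in B) b)%O = \top%O :> NC n <->
  forall x y : 'I_n, y \in pblock (\join_(b in B) b)%O x.
Proof.
split=> [-> x y|xy]; first by rewrite -nc_atom_le lex1.
apply/le_anti; rewrite lex1 /=; apply/refinesP => x.
by apply/subsetP => y _; apply: xy.
Qed.

(** If some [j > 0] had no parent, then [0] and [j] would be two vertices without
    parent in one component.  Conversely, going from parent to parent leads from
    any vertex to [0]. *)
Lemma NBB_join_topP B : NBB (@nc_tle n) B ->
  (\join_(b in B) b)%O = \top%O :> NC n <->
  forall j : 'I_n, 0 < j -> exists2 i : 'I_n, i < j & nc_atom i j \in B.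
Proof.
case/NBB_atom_graphP=> Bat ncB uB; split=> [/join_topP Btop j j0|par].
  have [/existsP[i /andP[]]|none] :=
    boolP [exists i : 'I_n, (i < j) && (nc_atom i j \in B)]; first by exists i.
  pose z : 'I_n := Ordinal (leq_ltn_trans (leq0n j) (ltn_ord j)).
  suff zj : z = j by rewrite -zj in j0.
  have zj : connect (atom_graph B) z j by rewrite -noncrossing_joinE.
  apply: connected_minima zj _ _ => //.
  - exact: atom_graph_sym.
  - exact: atom_graph_irr.
  move=> i ij; apply: contra none; rewrite atom_graph_sym atom_graphE // => ijB.
  by apply/existsP; exists i; rewrite ij.
suff root m (x z : 'I_n) : x <= m -> z = 0 :> nat ->
    x \in pblock (\join_(b in B) b)%O z.
  apply/join_topP => x y.
  pose z : 'I_n := Ordinal (leq_ltn_trans (leq0n x) (ltn_ord x)).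
  have zx : x \in pblock (\join_(b in B) b)%O z by apply: root (leqnn x) _.
  by rewrite -(NC_same_pblock zx); apply: root (leqnn y) _.
move=> + z0; elim: m x => [|m IHm] x xm.
  have -> : x = z by apply: val_inj => /=; lia.
  exact: NC_mem_pblock.
case: (posnP x) => [x0|/par[i ix ixB]]; first by apply: IHm; rewrite x0.
have zi : i \in pblock (\join_(b in B) b)%O z by apply: IHm; lia.
by rewrite (NC_same_pblock zi) -nc_atom_le join_ge_mem.
Qed.

(** The atoms of rank [r] in [B] correspond to the smaller neighbours of [r + 1].
    The two halves, at most one and at least one, are kept apart because the
    first comes from [B] being NBB and the second from its join. *)
Lemma card_rankP B :
  (forall r : nat, r.+1 < n -> #|B :&: nc_rank n r| = 1) <->
  unique_smaller_neighbour (atom_graph B) /\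
  forall j : 'I_n, 0 < j -> exists2 i : 'I_n, i < j & nc_atom i j \in B.
Proof.
split=> [rk|[uB par] r rn].
  have rkj (j : 'I_n) : 0 < j -> exists a, B :&: nc_rank n j.-1 = [set a].
    by move=> j0; apply/cards1P/eqP/rk; rewrite prednK.
  have mem (i j : 'I_n) : i < j -> nc_atom i j \in B ->
      nc_atom i j \in B :&: nc_rank n j.-1.
    move=> ij ijB; rewrite in_setI ijB; apply/nc_rankP; exists i, j.
    by split=> //; lia.
  split=> [x y z yx zx|j j0].
    rewrite ![atom_graph B x _]atom_graph_sym !atom_graphE //.
    have [|a aE] := rkj x; first by lia.
    move=> /(mem _ _ yx) + /(mem _ _ zx).
    rewrite aE !in_set1 => /eqP yE /eqP zE.
    by rewrite -zE in yE; case/nc_atom_inj: yE.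
  have [a aE] := rkj j j0; have : a \in B :&: nc_rank n j.-1 by rewrite aE set11.
  rewrite in_setI => /andP[aB /nc_rankP[i [k [ik kj a_ik]]]].
  have kE : k = j by apply: val_inj; rewrite /= kj prednK.
  by rewrite a_ik kE in aB; rewrite kE in ik; exists i.
have [//|i ij ijB] := par (Ordinal rn).
apply/eqP/cards1P; exists (nc_atom i (Ordinal rn)).
apply/setP => b; rewrite in_setI in_set1; apply/andP/eqP => [[bB]|->].
  case/nc_rankP=> k [j [kj jr bE]].
  have jE : j = Ordinal rn by apply: val_inj.
  rewrite {}jE {jr} in kj bE; rewrite bE in bB *; congr nc_atom.
  by apply: (uB (Ordinal rn)) => //; rewrite atom_graph_sym atom_graphE.
by split=> //; apply/nc_rankP; exists i, (Ordinal rn).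
Qed.

End AtomGraphs.

Theorem theorem2p2 (n : nat) (B : {set NC n}) :
  NBB_base (@nc_tle n) (\top%O : NC n) B <->
  [/\ B \subset atoms (NC n),
      forall r : nat, r.+1 < n -> #|B :&: nc_rank n r| = 1
    & noncrossing_graph (atom_graph B)].
Proof.
split=> [[nB Btop]|[Bat /card_rankP[uB par] ncB]].
  have [Bat ncB uB] := (NBB_atom_graphP B).1 nB.
  by split=> //; apply/card_rankP; split=> //; apply/(NBB_join_topP nB).
have nB : NBB (@nc_tle n) B by apply/NBB_atom_graphP.
by split=> //; apply/(NBB_join_topP nB).
Qed.
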